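(* For all integers $q\ge 2$ and $t\ge 1$, $$b_q(t)\le 128\,q^t.$$ More generally, every $q$-coloring of the edges of a complete bipartite graph with both class sizes at least $128\,q^t$ contains a monochromatic $K_{t,t}$.
   Context: For positive integers $t$ and $q$, $b_q(t)$ denotes the smallest integer $n$ such that every coloring of the edges of the complete bipartite graph $K_{n,n}$ with $q$ colors yields a monochromatic copy of $K_{t,t}$ (the complete bipartite graph with $t$ vertices in each class). *)

(* Defs.v *)
From mathcomp Require Import all_boot.

Set Implicit Arguments.
Unset Strict Implicit.
Unset Printing Implicit Defensive.

(* The edges of the complete bipartite graph with classes A and B are the
   elements of A * B, so a q-colouring is a c : {ffun A * B -> 'I_q}.  As both
   classes of K_{t,t} have t vertices, a copy of it may be taken to have its
   first class in A and its second class in B. *)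
Definition has_mono_Ktt (q t : nat) (A B : finType)
    (c : {ffun A * B -> 'I_q}) : bool :=
  [exists k : 'I_q, exists S : {set A}, exists T : {set B},
    [&& #|S| == t, #|T| == t &
      [forall x in S, forall y in T, c (x, y) == k]]].

Definition forces_mono_Ktt (q t n : nat) : bool :=
  [forall c : {ffun 'I_n * 'I_n -> 'I_q}, has_mono_Ktt t c].

Lemma pigeonhole_fiber (X Y : finType) (f : X -> Y) (t : nat) :
  #|Y| * t < #|X| ->
  exists (y : Y) (S : {set X}), #|S| = t /\ {in S, forall x, f x = y}.
Proof.
move=> ltYX; have [y ley]: exists y, t <= #|[set x | f x == y]|.
  apply/existsP; apply: contraLR ltYX => /existsPn small.
  rewrite -leqNgt -sum1_card (partition_big f xpredT) //= -sum_nat_const.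
  apply: leq_sum => y _; rewrite sum1_card.
  apply: ltnW; have := small y; rewrite -ltnNge.
  by apply: leq_trans; rewrite ltnS subset_leq_card //; apply/subsetP=> x; rewrite inE.
have /card_geqP[s [s_uniq <- sf]] := ley.
exists y, [set x in s]; split; first by rewrite cardsE (card_uniqP s_uniq).
by move=> x; rewrite inE => /sf; rewrite inE => /eqP.
Qed.

Lemma forces_mono_Ktt_ex (q t : nat) : exists n, forces_mono_Ktt q t n.
Proof.
pose m := (q * t).+1; exists (m + (q ^ m * t).+1).
apply/forallP => c.
pose f j := [ffun i : 'I_m => c (lshift _ i, j)].
have [|v [T [cardT Tv]]] := @pigeonhole_fiber _ _ f t.
  by rewrite card_ffun !card_ord addnS ltnS leq_addl.
have [|k [S [cardS Sk]]] := @pigeonhole_fiber _ _ v t.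
  by rewrite !card_ord.
apply/existsP; exists k; apply/existsP; exists (lshift _ @: S).
apply/existsP; exists T.
rewrite card_imset; last exact: lshift_inj.
rewrite cardS cardT !eqxx /=.
apply/forall_inP => _ /imsetP[i iS ->]; apply/forall_inP => j jT.
by rewrite -(Sk i iS) -(Tv j jT) ffunE.
Qed.

Definition bip_ramsey (q t : nat) : nat := ex_minn (forces_mono_Ktt_ex q t).

(* Main.v *)
Require Import Defs.
From mathcomp Require Import all_boot all_order all_algebra.
From mathcomp Require Import ring lra zify.

(** Take a colour whose graph has density [d >= 1/q] between the two classes.
For a bipartite graph with classes of sizes [a] and [b] in which a [K_{u,v}]
is wanted ([u] vertices from the first class, [v] from the second), put
[X = a * d ^ v] and [Y = b * d ^ u]: these are the common neighbourhood sizes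
that [v], respectively [u], random vertices would have in a random graph of
density [d].  The Kovari-Sos-Turan count says that [X >= u], or [Y >= v], up to
a factor close to 1, forces the biclique.  Here [u = v = t] and
[X, Y >= 128], so only large [t] are a problem.

The quantity that survives is the product [X * Y = a * b * d ^ (u + v)].
Choosing [s] vertices of one class and passing to their common neighbourhood
in the other class replaces [u] by [u - s]; by convexity (the tangent of
[x ^ n], and Chebyshev's sum inequality) the choice can be made so that the
product drops by a factor close to 1 only ([dense_common_nbrs],
[potential_step]).  Alternating between the two classes and each time
reducing the larger target to half of the smaller one, [(u, v)] becomes
[(v, v / 2)], and so on.  The losses form a convergent product, because [a]
and [b] stay exponentially large in [v] and [u].  Once [v <= 80], we still have
[X * Y] close to [128 ^ 2 = 2 ^ 14], which exceeds [u * v], so [X > u] or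
[Y > v] and the counting argument applies.

The product alone does not control the sizes of the classes: a tiny class
could be compensated by a density near 1.  Two arguments exclude this.  Since
there is no biclique, few vertices have a degree so large that [X] would
exceed [2 * u] if it were the average ([few_high_degree]); they are deleted
before each round, so the new [X] is at most [4 * u], hence the new
[Y] is not too small and the density grows only slightly.  Conversely,
if the new [X] is tiny then the new [Y] is huge, and the counting argument
finds the biclique at once ([degree_not_too_small] provides the degrees that
it needs).  The invariant is [supply], a round is [next_graph], and the
induction is [supply_biclique]. *)

Set Implicit Arguments.
Unset Strict Implicit.
Unset Printing Implicit Defensive.

Import Order.TTheory GRing.Theory Num.Theory.

(** * Bipartite graphs *)

Section Graph.
Context {X Y : finType} (E : X -> Y -> bool).
Implicit Types (A S : {set X}) (B T : {set Y}).

Definition nbrs A (y : Y) : {set X} := [set x in A | E x y].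
Definition common_nbrs B S : {set Y} := [set y in B | [forall x in S, E x y]].
Definition edges A B : nat := \sum_(y in B) #|nbrs A y|.
Definition biclique A B u v : bool :=
  [exists S : {set X}, exists T : {set Y},
    [&& S \subset A, T \subset B, #|S| == u, #|T| == v &
      [forall x in S, forall y in T, E x y]]].

Lemma bicliqueP A B u v : reflect (exists S T,
    [/\ S \subset A, T \subset B, #|S| = u, #|T| = v & {in S & T, forall x y, E x y}])
  (biclique A B u v).
Proof.
apply: (iffP existsP) => [[S /existsP[T /and5P[sSA sTB /eqP cS /eqP cT h]]]|[S [T [sSA sTB cS cT h]]]].
  by exists S, T; split=> // x y xS yT; move/forall_inP/(_ x xS)/forall_inP: h; apply.
exists S; apply/existsP; exists T; rewrite sSA sTB cS cT !eqxx /=.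
by apply/forall_inP => x xS; apply/forall_inP => y yT; apply: h.
Qed.

Lemma common_nbrsE A B S y : S \subset A ->
  (y \in common_nbrs B S) = (y \in B) && (S \subset nbrs A y).
Proof.
move=> sSA; rewrite inE; congr (_ && _); apply/forall_inP/subsetP => h x xS.
  by rewrite inE h // (subsetP sSA).
by have := h x xS; rewrite inE => /andP[].
Qed.

Lemma edges_le A B : (edges A B <= #|A| * #|B|)%N.
Proof.
rewrite mulnC -sum_nat_const; apply: leq_sum => y _.
by rewrite subset_leq_card //; apply/subsetP => x; rewrite inE => /andP[].
Qed.

Lemma biclique_ge A B u v S T : S \subset A -> T \subset B ->
  (u <= #|S|)%N -> (v <= #|T|)%N -> {in S & T, forall x y, E x y} -> biclique A B u v.
Proof.
move=> sSA sTB /card_geqP[s [us <- ss]] /card_geqP[t [ut <- st]] ST.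
apply/bicliqueP; exists [set x in s], [set y in t]; split.
- by apply/subsetP => x; rewrite inE => /ss /(subsetP sSA).
- by apply/subsetP => x; rewrite inE => /st /(subsetP sTB).
- by rewrite cardsE (card_uniqP us).
- by rewrite cardsE (card_uniqP ut).
- by move=> x y; rewrite !inE => /ss ? /st ?; apply: ST.
Qed.

(** Double counting of the pairs of an [s]-subset [S] of [A] and a common
neighbour [y] of [S]: for fixed [y], the set [S] ranges over the [s]-subsets
of the neighbourhood of [y]. *)
Lemma sum_over_common_nbrs A B s (F : {set X} -> Y -> nat) :
  \sum_(S : {set X} | (S \subset A) && (#|S| == s)) \sum_(y in common_nbrs B S) F S y =
  \sum_(y in B) \sum_(S : {set X} | (S \subset nbrs A y) && (#|S| == s)) F S y.
Proof.
rewrite (exchange_big_dep (mem B)) /=; last by move=> S y _; rewrite inE => /andP[].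
apply: eq_bigr => y yB; apply: eq_bigl => S.
have [sSN|nSN] := boolP (S \subset nbrs A y).
  have sSA : S \subset A.
    by apply: subset_trans sSN _; apply/subsetP => x; rewrite inE => /andP[].
  by rewrite sSA (@common_nbrsE A) // yB sSN /= andbT.
by apply/negbTE; apply: contra nSN => /andP[/andP[sSA _]]; rewrite (@common_nbrsE A) // => /andP[].
Qed.

Lemma sum_over_draws (T : finType) (D : {set T}) s c :
  (\sum_(S : {set T} | (S \subset D) && (#|S| == s)) c = 'C(#|D|, s) * c)%N.
Proof. by rewrite sum_nat_const -cards_draws cardsE; congr (_ * _)%N; apply: eq_card => S; rewrite !inE. Qed.

Lemma sum_card_common A B s :
  \sum_(S : {set X} | (S \subset A) && (#|S| == s)) #|common_nbrs B S| =
  \sum_(y in B) 'C(#|nbrs A y|, s).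
Proof.
under [LHS]eq_bigr do rewrite -sum1_card.
apply: etrans (sum_over_common_nbrs A B s (fun _ _ => 1%N)) _; apply: eq_bigr => y _.
by rewrite sum_over_draws muln1.
Qed.

(** The [s] vertices of [S] are excluded from the degrees, so that the
biclique found later in [A :\: S] is disjoint from [S]. *)
Lemma sum_edges_common A B s :
  \sum_(S : {set X} | (S \subset A) && (#|S| == s)) edges (A :\: S) (common_nbrs B S) =
  \sum_(y in B) 'C(#|nbrs A y|, s) * (#|nbrs A y| - s).
Proof.
apply: etrans (sum_over_common_nbrs A B s (fun S y => #|nbrs (A :\: S) y|)) _; apply: eq_bigr => y yB.
rewrite -sum_over_draws; apply: eq_bigr => S /andP[sSN /eqP <-].
rewrite -[in RHS](setIidPr sSN) -cardsD; apply: eq_card => x; rewrite !inE.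
by rewrite andbA.
Qed.

End Graph.

Definition flip (X Y : Type) (E : X -> Y -> bool) : Y -> X -> bool := fun y x => E x y.

Lemma edges_flip (X Y : finType) (E : X -> Y -> bool) (A : {set X}) (B : {set Y}) :
  edges (flip E) B A = edges E A B.
Proof.
rewrite /edges; under eq_bigr do rewrite -sum1_card.
under [RHS]eq_bigr do rewrite -sum1_card.
rewrite (exchange_big_dep (mem B)) /=; last by move=> x y _; rewrite inE => /andP[].
apply: eq_bigr => y yB; apply: eq_bigl => x; rewrite !inE yB.
by [].
Qed.

Lemma biclique_flip (X Y : finType) (E : X -> Y -> bool) (A : {set X}) (B : {set Y}) u v :
  biclique (flip E) B A v u -> biclique E A B u v.
Proof.
move=> /bicliqueP[T [S [? ? ? ? h]]]; apply/bicliqueP.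
by exists S, T; split=> // x y ? ?; apply: h.
Qed.

(** The vertices of [S] are complete to [common_nbrs E B1 S], so they can be
added to any biclique found there. *)
Lemma biclique_extend (X Y : finType) (E : X -> Y -> bool) (A S : {set X}) (B B1 : {set Y}) u v :
  S \subset A -> B1 \subset B -> biclique E (A :\: S) (common_nbrs E B1 S) u v ->
  biclique E A B (#|S| + u) v.
Proof.
move=> sSA sB1 /bicliqueP[S' [T [sS' sT <- <- h]]]; apply/bicliqueP.
have dSS' : [disjoint S & S'] by move: sS'; rewrite subsetD disjoint_sym => /andP[].
exists (S :|: S'), T; split=> //.
- by rewrite subUset sSA; apply: subset_trans sS' (subsetDl _ _).
- by apply: subset_trans sT (subset_trans _ sB1); apply/subsetP => y; rewrite inE => /andP[].
- by rewrite cardsU disjoint_setI0 // cards0 subn0.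
move=> x y; rewrite inE => /orP[xS yT|]; last exact: h.
by have := subsetP sT y yT; rewrite inE => /andP[_ /forall_inP]; apply.
Qed.

(** * Convexity inequalities *)

Section Real.
Local Open Scope ring_scope.
Context {R : realFieldType}.

(** The graph of [x ^ n] lies above its tangent at [l].  Summed over a family
whose mean is at least [l], the linear term is nonnegative, which gives the
power mean inequality in the weighted form used below. *)
Lemma power_tangent (x l : R) n : 0 <= x -> 0 <= l ->
  l ^+ n + n%:R * l ^+ n.-1 * (x - l) <= x ^+ n.
Proof.
move=> x0 l0; case: n => [|n]; first by rewrite !expr0 !mul0r addr0.
elim: n => [|n IH]; first by rewrite !expr1 expr0; lra.
rewrite exprS [in leRHS]exprS /=.
apply: le_trans (ler_wpM2l x0 IH); rewrite /= [l ^+ n.+1]exprS.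
have := mulr_ge0 (exprn_ge0 n l0) (sqr_ge0 (x - l)).
have := mulr_ge0 (ler0n R n) (mulr_ge0 (exprn_ge0 n l0) (sqr_ge0 (x - l))).
rewrite -!natr1; move: (l ^+ n) => p; nra.
Qed.

Lemma bernoulli_ineq (x : R) n : 0 <= x <= 1 -> 1 - n%:R * x <= (1 - x) ^+ n.
Proof.
move=> /andP[x0 x1]; have := @power_tangent (1 - x) 1 n.
rewrite !expr1n; lra.
Qed.

(** Chebyshev's sum inequality: weights that increase with [d] can only
increase the mean [g] of [d].  Every term of the sum of
[(w (d i) - w m) * (d i - g)] is nonnegative when [m] is the integer part
of [g]. *)
Lemma chebyshev_sum (I : finType) (P : pred I) (d : I -> nat) (w : nat -> R) (g : R) :
  {homo w : m n / (m <= n)%N >-> m <= n} ->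
  \sum_(i | P i) (d i)%:R = g * #|[pred i | P i]|%:R ->
  g * \sum_(i | P i) w (d i) <= \sum_(i | P i) w (d i) * (d i)%:R.
Proof.
move=> wmono sd; set N := #|_| in sd; set D := (\sum_(i | P i) d i)%N.
have [N0|Npos] := posnP N.
  have P0 i : P i = false by have := card0_eq N0 i; rewrite inE.
  by rewrite !big_pred0 // mulr0.
pose m := (D %/ N)%N.
have Dg : D%:R = g * N%:R by rewrite -sd natr_sum.
have NR : 0 < N%:R :> R by rewrite ltr0n.
suff : 0 <= \sum_(i | P i) (w (d i) - w m) * ((d i)%:R - g).
  have -> : \sum_(i | P i) (w (d i) - w m) * ((d i)%:R - g) =
      \sum_(i | P i) w (d i) * (d i)%:R - g * (\sum_(i | P i) w (d i))
      - w m * (\sum_(i | P i) (d i)%:R - \sum_(i | P i) g).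
    by rewrite !mulr_sumr -!sumrB mulr_sumr -!sumrB; apply: eq_bigr => i _; ring.
  by rewrite sd sumr_const mulr_natr subrr mulr0 subr0 subr_ge0.
apply: sumr_ge0 => i _; case: (lerP g (d i)%:R) => h.
  rewrite mulr_ge0 ?subr_ge0 //; apply: wmono; rewrite /m.
  rewrite -ltnS ltn_divLR // -(ltr_nat R) Dg natrM.
  rewrite ltr_pM2r //; apply: le_lt_trans h _; by rewrite ltr_nat.
(* Below the mean, both factors are nonpositive. *)
rewrite nmulr_lge0 ?subr_lt0 // subr_le0; apply: wmono.
by rewrite /m leq_divRL // -(ler_nat R) Dg natrM ler_pM2r // ltW.
Qed.

(** * Choosing vertices with a dense common neighbourhood *)

(** Jensen's inequality for the falling factorial, in the weak form
[d ^_ s >= (d - s) ^ s], which is good enough when the mean degree is much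
larger than [s ^ 2]. *)
Lemma sum_binomial_ge (I : finType) (P : pred I) (d : I -> nat) s (l : R) :
  0 <= l -> l * #|[pred i | P i]|%:R <= \sum_(i | P i) ((d i)%:R - s%:R) ->
  #|[pred i | P i]|%:R * l ^+ s <= \sum_(i | P i) ('C(d i, s) * s`!)%:R.
Proof.
move=> l0 sl; set N := #|_| in sl *.
apply: (@le_trans _ _ (\sum_(i | P i) (l ^+ s + s%:R * l ^+ s.-1 * ((d i)%:R - s%:R - l)))).
  rewrite big_split /= sumr_const -/N -mulr_sumr sumrB sumr_const -/N -[l *+ _]mulr_natr -[l ^+ s *+ _]mulr_natl.
  by rewrite lerDl mulr_ge0 ?subr_ge0 // mulr_ge0 ?exprn_ge0.
apply: ler_sum => i _; rewrite bin_ffact.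
apply: (@le_trans _ _ ((d i - s)%:R ^+ s)).
  apply: le_trans (power_tangent s (ler0n _ _) l0).
  rewrite lerD2l ler_wpM2l ?mulr_ge0 ?exprn_ge0 // lerD2r.
  by rewrite lerBlDr -natrD ler_nat; lia.
rewrite -natrX ler_nat; have aux k : (k <= s)%N -> ((d i - s) ^ k <= d i ^_ k)%N; last exact: aux.
elim: k => [|k IH] ks //; rewrite expnSr ffactnSr leq_mul ?IH ?(ltnW ks) //; lia.
Qed.

(** The step that drives the proof.  For a random [s]-subset [S] of [A], let
[b] be the size of its common neighbourhood and [e] the number of edges from
there to the rest of [A].  The function [e ^ T / b ^ (T - 1)], that is
[b * (e / b) ^ T], is convex and homogeneous, so its mean is at least its
value at the means of [e] and [b]; and the ratio of these means is at least
[g - s], because [S] favours the vertices of large degree.  The exponent [T]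
is free: it fixes the rate at which size may be traded for density. *)
Lemma dense_common_nbrs (X Y : finType) (E : X -> Y -> bool) (A : {set X}) (B : {set Y}) s T :
  let g : R := (edges E A B)%:R / #|B|%:R in s%:R < g ->
  exists S : {set X}, let B' := common_nbrs E B S in
    [/\ S \subset A, #|S| = s &
     #|B|%:R * (g - s%:R) ^+ (s + T) <=
       #|B'|%:R * ((edges E (A :\: S) B')%:R / #|B'|%:R) ^+ T * #|A|%:R ^+ s].
Proof.
move=> g sg.
have B0 : (0 < #|B|)%N.
  by rewrite lt0n; apply/eqP => B0; move: sg; rewrite /g B0 invr0 mulr0 ltrn0.
have bR : 0 < #|B|%:R :> R by rewrite ltr0n.
have eg : (edges E A B)%:R = g * #|B|%:R by rewrite /g divfK // gt_eqF.
pose l := g - s%:R; have l0 : 0 < l by rewrite subr_gt0.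
pose Q := [pred S : {set X} | (S \subset A) && (#|S| == s)].
pose b S := #|common_nbrs E B S|; pose e S := edges E (A :\: S) (common_nbrs E B S).
pose d y := #|nbrs E A y|.
have Bpred : #|[pred y in B]| = #|B| by apply: eq_card.
have sumd : \sum_(y in B) (d y)%:R = g * #|[pred y in B]|%:R :> R.
  by rewrite -natr_sum Bpred -eg.
have sumb : \sum_(S | Q S) (b S)%:R = \sum_(y in B) 'C(d y, s)%:R :> R.
  by rewrite -!natr_sum -sum_card_common.
have sume : l * \sum_(S | Q S) (b S)%:R <= \sum_(S | Q S) (e S)%:R.
  rewrite sumb -[in leRHS]natr_sum (sum_edges_common E A B s) natr_sum.
  have -> : \sum_(y in B) ('C(d y, s) * (d y - s))%:R =
     \sum_(y in B) 'C(d y, s)%:R * (d y)%:R - s%:R * (\sum_(y in B) 'C(d y, s)%:R) :> R.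
    rewrite mulr_sumr -sumrB; apply: eq_bigr => y _; rewrite natrM.
    have [ds|sd] := ltnP (d y) s; first by rewrite bin_small // !mul0r mulr0 subr0.
    by rewrite natrB //; ring.
  rewrite mulrBl lerB // (chebyshev_sum (w := fun n => 'C(n, s)%:R)) //.
  by move=> m n mn; rewrite ler_nat leq_bin2l.
have bl : #|B|%:R * l ^+ s <= s`!%:R * \sum_(S | Q S) (b S)%:R.
  rewrite sumb mulr_sumr -Bpred.
  under [leRHS]eq_bigr do rewrite mulrC -natrM.
  apply: sum_binomial_ge; first exact: ltW.
  by rewrite sumrB sumd sumr_const Bpred -[s%:R *+ _]mulr_natr /l mulrBl.
have Qcard : #|Q| = 'C(#|A|, s) by rewrite -cards_draws -cardsE; apply: eq_card => S; rewrite !inE.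
(* At a maximizer of [b * (e / b) ^ T], the value is at least the mean. *)
have [S QS maxS] : exists2 S, Q S & forall S', Q S' ->
    (b S')%:R * ((e S')%:R / (b S')%:R) ^+ T <= (b S)%:R * ((e S)%:R / (b S)%:R) ^+ T :> R.
  have [S0 QS0] : exists S, Q S.
    apply/existsP; apply: contraLR (bl) => /existsPn Q0.
    rewrite -ltNge big1 => [|S QS]; last by move: (Q0 S); rewrite QS.
    by rewrite mulr0 mulr_gt0 ?exprn_gt0.
  have [S QS mS] := @Order.TotalTheory.arg_maxP _ _ _ S0 Q
    (fun S => (b S)%:R * ((e S)%:R / (b S)%:R) ^+ T : R) QS0.
  by exists S.
have /andP[sSA /eqP cS] := QS.
exists S; split=> //=; rewrite -/(b S) -/(e S) -/l exprD.
set M := (b S)%:R * _ in maxS *.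
(* Averaging over [Q]: the linear terms of the tangents add up to at least 0. *)
have lower : l ^+ T * (\sum_(S | Q S) (b S)%:R) <= 'C(#|A|, s)%:R * M.
  rewrite -Qcard mulr_natl -sumr_const.
  apply: le_trans (ler_sum _ (fun S' QS' => maxS S' QS')).
  apply: (@le_trans _ _ (\sum_(S | Q S) (l ^+ T * (b S)%:R
     + T%:R * l ^+ T.-1 * ((e S)%:R - l * (b S)%:R)))).
    rewrite big_split /= -mulr_sumr lerDl -mulr_sumr sumrB -mulr_sumr.
    by rewrite mulr_ge0 ?subr_ge0 // mulr_ge0 ?exprn_ge0 ?(ltW l0).
  apply: ler_sum => S' _; have [b0|bpos] := posnP (b S').
    have -> : e S' = 0%N.
      by rewrite /e /edges big_pred0 // => y; have := card0_eq b0 y.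
    by rewrite b0 !mulr0 subrr mulr0 addr0 mul0r.
  have bS : 0 < (b S')%:R :> R by rewrite ltr0n.
  have := ler_wpM2l (ltW bS) (@power_tangent ((e S')%:R / (b S')%:R) l T _ (ltW l0)).
  rewrite divr_ge0 // => /(_ isT); apply: le_trans.
  rewrite le_eqVlt; apply/orP; left; apply/eqP; field; by rewrite gt_eqF.
have M0 : 0 <= M by rewrite mulr_ge0 // exprn_ge0 // divr_ge0.
rewrite mulrA; apply: (@le_trans _ _ (s`!%:R * (\sum_(S | Q S) (b S)%:R) * l ^+ T)).
  by rewrite ler_wpM2r // exprn_ge0 // ltW.
rewrite -mulrA [_ * l ^+ T]mulrC.
apply: le_trans (ler_wpM2l (ler0n _ _) lower) _.
rewrite mulrA [_ * M]mulrC ler_wpM2l // -natrM mulnC bin_ffact -natrX ler_nat.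
by elim: (s) => [|k IH]; rewrite // expnSr ffactnSr leq_mul // leq_subr.
Qed.

(** * The Kovari-Sos-Turan count *)

Definition dens (X Y : finType) (E : X -> Y -> bool) (A : {set X}) (B : {set Y}) : R :=
  (edges E A B)%:R / (#|A|%:R * #|B|%:R).

Lemma dens_flip (X Y : finType) (E : X -> Y -> bool) (A : {set X}) (B : {set Y}) :
  dens (flip E) B A = dens E A B.
Proof. by rewrite /dens edges_flip [#|B|%:R * _]mulrC. Qed.

Lemma dens_ge0 (X Y : finType) (E : X -> Y -> bool) (A : {set X}) (B : {set Y}) :
  0 <= dens E A B.
Proof. by rewrite divr_ge0 // mulr_ge0. Qed.

(** The case [T = 0] of the previous step, with the two classes exchanged:
some [v] vertices of [B] have at least [a * (d - v / b) ^ v] common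
neighbours, and [16 * v ^ 2 <= b * d] keeps this above [15 / 16] of
[a * d ^ v]. *)
Lemma kovari_sos_turan (X Y : finType) (E : X -> Y -> bool) (A : {set X}) (B : {set Y}) u v :
  (0 < v)%N -> 16 * v%:R ^+ 2 <= #|B|%:R * dens E A B ->
  16 * u%:R <= 15 * (#|A|%:R * dens E A B ^+ v) -> biclique E A B u v.
Proof.
move=> v0 hb ha; set a : R := #|A|%:R in ha; set b : R := #|B|%:R in hb.
set d := dens E A B in ha hb.
have V1 : 1 <= v%:R :> R by rewrite ler1n.
have bd0 : 0 < b * d by apply: lt_le_trans hb; rewrite mulr_gt0 ?exprn_gt0 //; lra.
have d0 : 0 < d.
  rewrite lt_neqAle dens_ge0 andbT; apply/eqP => d0.
  by move: bd0; rewrite -d0 mulr0 ltxx.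
have b0 : 0 < b by rewrite -(pmulr_lgt0 _ d0).
have A0 : (0 < #|A|)%N.
  rewrite lt0n; apply/eqP => A0; move: d0.
  by rewrite /d /dens A0 mul0r invr0 mulr0 ltxx.
have a0 : 0 < a by rewrite ltr0n.
have gE : (edges (flip E) B A)%:R / #|A|%:R = b * d.
  rewrite edges_flip /d /dens -/a -/b; field.
  by rewrite !gt_eqF.
clearbody d.
have vg : v%:R < b * d by apply: lt_le_trans hb; nra.
have := @dense_common_nbrs _ _ (flip E) B A v 0.
rewrite gE => /(_ vg) [T [sTB cT]]; rewrite addn0 expr0 mulr1 -/a -/b => hT.
set A' := common_nbrs _ _ _ in hT.
apply: (@biclique_ge _ _ E A B u v A' T) => //; last 2 first.
- by rewrite cT.
- move=> x y; rewrite inE => /andP[_ /forall_inP h] yT; exact: h.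
- by apply/subsetP => x; rewrite inE => /andP[].
rewrite -(ler_nat R).
(* Bernoulli: the relative loss is at most [v * (v / (b * d)) <= 1 / 16]. *)
have q0 : 0 <= v%:R / (b * d) <= 1.
  apply/andP; split; first exact: divr_ge0 (ltW bd0).
  by rewrite ler_pdivrMr // mul1r ltW.
have := bernoulli_ineq v q0.
have -> : 1 - v%:R * (v%:R / (b * d)) = 1 - v%:R ^+ 2 / (b * d) by rewrite expr2 mulrA.
have : v%:R ^+ 2 / (b * d) <= 1 / 16 by rewrite ler_pdivrMr //; lra.
have gv : b * d - v%:R = b * (d * (1 - v%:R / (b * d))).
  by field; rewrite !gt_eqF.
rewrite gv !exprMn [a * _]mulrCA [leRHS]mulrC in hT.
rewrite ler_pM2l ?exprn_gt0 // [a * _]mulrA in hT.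
move: hT.
set Z := a * d ^+ v in ha *; set W := (1 - _) ^+ v.
have Z0 : 0 < Z by rewrite mulr_gt0 // exprn_gt0.
move=> h1 h2 h3; nra.
Qed.

(** * The invariant and what it says about degrees *)

(** Past [v0], the left-hand side grows by a factor of at most
[(1 + 1 / v0) ^ m <= c] when [v] increases by one. *)
Lemma poly_le_exp (c K : R) (m v0 v : nat) : 0 <= K -> (0 < v0)%N ->
  K * v0%:R ^+ m <= c ^+ v0 -> v0.+1%:R ^+ m <= c * v0%:R ^+ m ->
  (v0 <= v)%N -> K * v%:R ^+ m <= c ^+ v.
Proof.
move=> K0 v00 base ratio /subnK <-; elim: (v - v0)%N => [|j IH] //.
rewrite addSn; set w := (j + v0)%N in IH *.
have v0m : (0 : R) < v0%:R ^+ m by rewrite exprn_gt0 ?ltr0n.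
have c0 : 0 < c by rewrite -(pmulr_lgt0 _ v0m) (lt_le_trans _ ratio) ?exprn_gt0 ?ltr0n.
rewrite exprS; apply: le_trans (ler_wpM2l (ltW c0) IH).
rewrite mulrCA ler_wpM2l // -(ler_pM2r v0m) -exprMn -mulrAC.
apply: (@le_trans _ _ ((v0.+1%:R * w%:R) ^+ m)).
  rewrite lerXn2r ?nnegrE ?mulr_ge0 ?ler0n // -!natrM ler_nat; have := leq_addl j v0; rewrite -/w; nia.
by rewrite exprMn ler_wpM2r ?exprn_ge0 ?ler0n.
Qed.

Lemma poly_bounds_40 (v : nat) : (40 <= v)%N ->
  v%:R ^+ 2 <= (5 / 4) ^+ v :> R /\ 213 * v%:R ^+ 3 <= (8 / 5) ^+ v :> R.
Proof.
move=> h; split; last by apply: (poly_le_exp _ _ _ _ h) => //; lra.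
by rewrite -[X in X <= _]mul1r; apply: (poly_le_exp _ _ _ _ h) => //; lra.
Qed.

Lemma poly_bounds_81 (v : nat) : (81 <= v)%N ->
  984 * v%:R ^+ 5 <= (8 / 5) ^+ v :> R /\ 576 * v%:R ^+ 8 <= 2 ^+ v :> R.
Proof. by move=> h; split; apply: (poly_le_exp _ _ _ _ h) => //; lra. Qed.

(** The invariant of the induction.  The first condition bounds the density by a
constant below 1 ([supply_dens]), so that the classes, of sizes at least
about [d ^ - v] and [d ^ - u], are exponentially large.  The second one keeps
[X * Y] near [128 ^ 2]; the term [v ^ -1], which grows as [v] is halved, pays for
the loss of each round.  The last two only exclude degenerate cases; the
absence of bicliques then improves them. *)
Definition supply (u v : nat) (a b d : R) : Prop :=
  [/\ (2 * d) ^+ v <= v%:R ^+ 2,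
      2 ^+ 14 * (1 - v%:R^-1) <= (a * d ^+ v) * (b * d ^+ u),
      1 <= u%:R * (a * d ^+ v) & 1 <= u%:R * (b * d ^+ u)].

Lemma supply_gt0 u v a b d : 0 <= a -> 0 <= b -> 0 <= d -> (0 < v)%N -> (0 < u)%N ->
  supply u v a b d -> [/\ 0 < a, 0 < b & 0 < d].
Proof.
move=> a0 b0 d0 v0 u0 [_ _ hX hY].
split; rewrite lt_neqAle ?a0 ?b0 ?d0 andbT; apply/eqP => z.
- by move: hX; rewrite -z mul0r mulr0 ler10.
- by move: hY; rewrite -z mul0r mulr0 ler10.
- by move: hX; rewrite -z expr0n gtn_eqF // !mulr0 ler10.
Qed.

(** For [v >= 40] the first condition of [supply] would fail at a density
above [5 / 8], since [(5 / 4) ^ v >= v ^ 2]. *)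
Lemma supply_dens u v a b d : 0 <= d -> (40 <= v)%N -> supply u v a b d -> d <= 5 / 8.
Proof.
move=> d0 v40 [hd _ _ _]; have vn0 : v != 0%N by case: (v) v40.
rewrite leNgt; apply/negP => dlt.
have [h _] := poly_bounds_40 v40.
have : (5 / 4) ^+ v < (2 * d) ^+ v.
  by rewrite ltrXn2r; (exact: vn0 || lra).
by lra.
Qed.

Lemma peel_powers (x d : R) j k : 0 <= x -> 0 < d <= 5 / 8 -> (j <= k)%N ->
  (8 / 5) ^+ j * (x * d ^+ k) <= x.
Proof.
move=> x0 /andP[d0 d58] jk.
rewrite mulrCA ler_piMr // -(subnK jk) exprD mulrCA -exprMn.
by apply: mulr_ile1; rewrite ?exprn_ge0 ?exprn_ile1 //; lra.
Qed.

(** The average degrees are large enough for the Kovari-Sos-Turan count in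
both directions. *)
Lemma supply_degrees u v a b d : 0 <= a -> 0 <= b -> 0 <= d ->
  (40 <= v)%N -> (v <= u <= 2 * v + 1)%N -> supply u v a b d ->
  16 * u%:R ^+ 2 <= a * d /\ 16 * v%:R ^+ 2 <= b * d.
Proof.
move=> a0 b0 d0 v40 /andP[vu uv].
have v0 : (0 < v)%N by lia.
have u00 : (0 < u)%N by lia.
have vE : v.-1.+1 = v by lia.
have uE : u.-1.+1 = u by lia.
have vu1 : (v.-1 <= u.-1)%N by lia.
move=> g; have [a1 b1 d1] := supply_gt0 a0 b0 d0 v0 u00 g.
have d58 := supply_dens d0 v40 g.
have [hd _ hX hY] := g.
have [_ hv] := poly_bounds_40 v40.
have dI : 0 < d <= 5 / 8 by rewrite d1.
have v40R : 40 <= v%:R :> R by rewrite (ler_nat R 40).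
have vuR : v%:R <= u%:R :> R by rewrite ler_nat.
have uvR : u%:R <= 2 * v%:R + 1 :> R by rewrite -natrM natr1 -addn1 ler_nat.
have hX1 := @peel_powers (a * d) d v.-1 v.-1 (mulr_ge0 a0 d0) dI (leqnn _).
have hY1 := @peel_powers (b * d) d v.-1 u.-1 (mulr_ge0 b0 d0) dI.
rewrite -mulrA -exprS vE in hX1; rewrite -mulrA -exprS uE in hY1.
have {}hY1 := hY1 vu1.
have {}hv : 213 * v%:R ^+ 3 <= 8 / 5 * (8 / 5) ^+ v.-1 :> R by rewrite -exprS vE.
set P := (8 / 5) ^+ v.-1 in hv hX1 hY1.
have P0 : 0 < P by rewrite exprn_gt0 //; lra.
have u0 : 0 < u%:R :> R by rewrite ltr0n.
have key : u%:R * (16 * u%:R ^+ 2) <= P :> R.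
  have uu : 40 * u%:R <= 81 * v%:R :> R by clear -uvR v40R; lra.
  have e1 : u%:R * (16 * u%:R ^+ 2) = 16 * u%:R ^+ 3 :> R by ring.
  have : (40 * u%:R) ^+ 3 <= (81 * v%:R) ^+ 3 :> R.
    by rewrite lerXn2r ?nnegrE ?mulr_ge0.
  have : 0 <= v%:R ^+ 3 :> R by rewrite exprn_ge0.
  rewrite e1 !exprMn; clearbody P; clear -hv => h1 h2; lra.
have lem Z W : 1 <= u%:R * Z -> P * Z <= W -> 16 * u%:R ^+ 2 <= W.
  move=> h1 h2; rewrite -(ler_pM2l u0); apply: le_trans key _.
  apply: le_trans (ler_wpM2l (ltW u0) h2); rewrite mulrCA.
  by rewrite ler_peMr // ltW.
split; first exact: lem hX hX1.
apply: le_trans (lem _ _ hY hY1); rewrite ler_pM2l //.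
by rewrite lerXn2r ?nnegrE.
Qed.

(** The stronger lower bounds make the losses of one round, which are of order
[v / (a * d)] and [v ^ 2 / (b * d ^ 2)] in the average degree, smaller than
[1 / v] after they are raised to the power [u + v]. *)
Lemma supply_degrees_81 u v a b d : 0 <= a -> 0 <= b -> 0 <= d ->
  (81 <= v)%N -> (v <= u <= 2 * v + 1)%N -> supply u v a b d ->
  16 * v%:R ^+ 3 <= a * d /\ 128 * v%:R ^+ 4 <= b * d ^+ 2.
Proof.
move=> a0 b0 d0 v81 /andP[vu uv].
have v0 : (0 < v)%N by lia.
have u00 : (0 < u)%N by lia.
have v40 : (40 <= v)%N by lia.
have vE : v.-2.+2 = v by lia.
have vE1 : v.-1.+1 = v by lia.
have uE : u.-2.+2 = u by lia.
have v21 : (v.-2 <= v.-1)%N by lia.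
have vu2 : (v.-2 <= u.-2)%N by lia.
move=> g; have [a1 b1 d1] := supply_gt0 a0 b0 d0 v0 u00 g.
have d58 := supply_dens d0 v40 g.
have [hd _ hX hY] := g.
have [hv _] := poly_bounds_81 v81.
have dI : 0 < d <= 5 / 8 by rewrite d1.
have v81R : 81 <= v%:R :> R by rewrite (ler_nat R 81).
have vuR : v%:R <= u%:R :> R by rewrite ler_nat.
have uvR : u%:R <= 2 * v%:R + 1 :> R by rewrite -natrM natr1 -addn1 ler_nat.
have hX1 := @peel_powers (a * d) d v.-2 v.-1 (mulr_ge0 a0 d0) dI v21.
have hY1 := @peel_powers (b * d ^+ 2) d v.-2 u.-2 (mulr_ge0 b0 (exprn_ge0 2 d0)) dI vu2.
rewrite -mulrA -exprS vE1 in hX1; rewrite -mulrA -exprD add2n uE in hY1.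
have {}hv : 984 * v%:R ^+ 5 <= 8 / 5 * (8 / 5 * (8 / 5) ^+ v.-2) :> R by rewrite -!exprS vE.
set P := (8 / 5) ^+ v.-2 in hv hX1 hY1.
have P0 : 0 < P by rewrite exprn_gt0 //; lra.
have u0 : 0 < u%:R :> R by rewrite ltr0n.
have v4 : 0 <= v%:R ^+ 4 :> R by rewrite exprn_ge0.
have key : u%:R * (128 * v%:R ^+ 4) <= P :> R.
  apply: (@le_trans _ _ (3 * v%:R * (128 * v%:R ^+ 4))).
    by rewrite ler_wpM2r //; [apply: mulr_ge0 => //; lra | lra].
  have -> : 3 * v%:R * (128 * v%:R ^+ 4) = 384 * v%:R ^+ 5 :> R by ring.
  lra.
have lem Z W : 1 <= u%:R * Z -> P * Z <= W -> 128 * v%:R ^+ 4 <= W.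
  move=> h1 h2; rewrite -(ler_pM2l u0); apply: le_trans key _.
  apply: le_trans (ler_wpM2l (ltW u0) h2); rewrite mulrCA.
  by rewrite ler_peMr // ltW.
split; last exact: lem hY hY1.
apply: le_trans (lem _ _ hX hX1).
have : 0 <= v%:R ^+ 3 :> R by rewrite exprn_ge0.
rewrite [v%:R ^+ 4]exprS; nra.
Qed.

(** * The effect of one round on the parameters *)

(** The function [be * y ^ n] decreases in [be] when the total [be * y] is
fixed, so deleting vertices of one class can only help if few edges are lost. *)
Lemma power_perspective (be b x y : R) n : 0 < be <= b -> 0 <= x -> x * b <= be * y ->
  b * x ^+ n.+1 <= be * y ^+ n.+1.
Proof.
move=> /andP[be0 beb] x0 h; have b0 : 0 < b by apply: lt_le_trans beb.
have y0 : 0 <= y.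
  by rewrite -(pmulr_rge0 _ be0); apply: le_trans h; rewrite mulr_ge0 // ltW.
have hp : (x * b) ^+ n.+1 <= (be * y) ^+ n.+1.
  by rewrite lerXn2r // nnegrE mulr_ge0 // ltW.
have bn : be ^+ n <= b ^+ n by rewrite lerXn2r // nnegrE ltW.
rewrite -(ler_pM2l (exprn_gt0 n b0)).
have -> : b ^+ n * (b * x ^+ n.+1) = (x * b) ^+ n.+1 by rewrite exprMn [b ^+ n.+1]exprS; ring.
apply: le_trans hp _.
have -> : (be * y) ^+ n.+1 = be ^+ n * (be * y ^+ n.+1) by rewrite exprMn [be ^+ n.+1]exprS; ring.
by rewrite ler_wpM2r // mulr_ge0 ?exprn_ge0 // ltW.
Qed.

(** The exponent [T = u + v] in [dense_common_nbrs] is the one that makes the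
powers of [a] cancel, so that the product [X * Y] is preserved up to the
factor [(1 - l) ^ (s + u + v)], bounded below by Bernoulli's inequality.  Here
[l] is the relative loss in the average degree, and [a' * d'] is the new average degree. *)
Lemma potential_step (u s v : nat) (a b d a' b' d' l : R) :
  (0 < v)%N -> 0 < a -> 0 < b -> 0 < d -> 0 <= a' <= a -> 0 <= b' -> 0 <= d' ->
  0 <= l <= 1 ->
  b * (a * d * (1 - l)) ^+ (s + (u + v)) <= b' * (a' * d') ^+ (u + v) * a ^+ s ->
  (1 - (s + u + v)%:R * l) * ((a * d ^+ v) * (b * d ^+ (s + u))) <= (a' * d' ^+ v) * (b' * d' ^+ u).
Proof.
case: v => // v _ a0 b0 d0 /andP[a'0 a'a] b'0 d'0 l01 h.
have bern := bernoulli_ineq (s + u + v.+1) l01.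
rewrite -(ler_pM2l (exprn_gt0 (s + u + v) a0)).
apply: (@le_trans _ _ (b * (a * d * (1 - l)) ^+ (s + (u + v.+1)))).
  rewrite addnA !exprMn.
  have -> : b * (a ^+ (s + u + v.+1) * d ^+ (s + u + v.+1) * (1 - l) ^+ (s + u + v.+1)) =
    (a ^+ (s + u + v.+1) * (b * d ^+ (s + u + v.+1))) * (1 - l) ^+ (s + u + v.+1) by ring.
  have -> : a ^+ (s + u + v) * ((1 - (s + u + v.+1)%:R * l) * (a * d ^+ v.+1 * (b * d ^+ (s + u)))) =
    (a ^+ (s + u + v.+1) * (b * d ^+ (s + u + v.+1))) * (1 - (s + u + v.+1)%:R * l).
    rewrite addnS [a ^+ _.+1]exprSr -addnS [d ^+ (_ + v.+1)]exprD; ring.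
  by rewrite ler_wpM2l // mulr_ge0 ?exprn_ge0 ?mulr_ge0 ?exprn_ge0 ?(ltW a0) ?(ltW b0) ?(ltW d0).
apply: le_trans h _.
have -> : b' * (a' * d') ^+ (u + v.+1) * a ^+ s = (b' * d' ^+ (u + v.+1) * a' * a ^+ s) * a' ^+ (u + v).
  by rewrite exprMn addnS [a' ^+ _.+1]exprS; ring.
have -> : a ^+ (s + u + v) * (a' * d' ^+ v.+1 * (b' * d' ^+ u)) =
   (b' * d' ^+ (u + v.+1) * a' * a ^+ s) * a ^+ (u + v).
  rewrite -addnA exprD [d' ^+ (u + _)]exprD; ring.
rewrite ler_wpM2l ?mulr_ge0 ?exprn_ge0 ?(ltW a0) //.
by rewrite lerXn2r ?nnegrE ?(ltW a0).
Qed.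

(** Given [p = d ^ v], the hypotheses say that [d'] is at most about [p], while
[b] is at most about [p ^ -3]; then [b * d' ^ (k + 8)] is at most about
[p ^ (k + 5)], up to powers of [w], which [w ^ 2 * p <= 1] absorbs. *)
Lemma dens_not_too_small (k : nat) (b p d' w : R) :
  0 <= b -> 0 < p -> 1 < w -> w ^+ 2 * p <= 1 -> 0 <= d' -> d' <= w * p -> b * p ^+ 3 <= w ->
  1 <= b * d' ^+ (k + 8) -> False.
Proof.
move=> b0 p0 w1 wp d'0 d'wp bp h.
have w0 : 0 < w by lra.
have h1 : 1 <= b * (w * p) ^+ (k + 8).
  apply: le_trans h _; rewrite ler_wpM2l // lerXn2r ?nnegrE //.
  by rewrite mulr_ge0 // ltW.
have h2 : p ^+ 3 <= w * (w * p) ^+ (k + 8).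
  rewrite -[leLHS]mulr1; apply: le_trans (ler_wpM2l (exprn_ge0 3 (ltW p0)) h1) _.
  by rewrite mulrA [p ^+ 3 * b]mulrC ler_wpM2r // exprn_ge0 // mulr_ge0 // ltW.
have h3 : w ^+ (k.+1) * (w * (w * p) ^+ (k + 8)) <= p ^+ 3.
  have -> : w ^+ (k.+1) * (w * (w * p) ^+ (k + 8)) = (w ^+ 2 * p) ^+ (k + 5) * p ^+ 3.
    by rewrite !exprMn !exprD exprS; ring.
  rewrite ler_piMl ?exprn_ge0 ?(ltW p0) // exprn_ile1 //.
  by rewrite mulr_ge0 ?exprn_ge0 ?(ltW p0) ?(ltW w0).
have h4 : 1 < w ^+ k.+1 by rewrite exprn_egt1.
have P3 : 0 < p ^+ 3 by rewrite exprn_gt0.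
have := le_trans (ler_wpM2l (ltW (lt_trans ltr01 h4)) h2) h3.
by rewrite leNgt -[X in X < _]mul1r ltr_pM2r // h4.
Qed.

Lemma exp_le_double (n : nat) (a a' c : R) :
  0 < a -> 0 <= c -> n%:R <= c -> 4 * c ^+ 2 <= a -> 4 * c <= a -> a - 2 * c <= a' ->
  a ^+ n <= 2 * a' ^+ n.
Proof.
move=> a0 c0 nc ca ca1 aa'.
have x0 : 0 <= 2 * c / a by rewrite divr_ge0 ?mulr_ge0 // ltW.
have x1 : 2 * c / a <= 1 by rewrite ler_pdivrMr //; lra.
have x01 : 0 <= 2 * c / a <= 1 by rewrite x0.
have bern := bernoulli_ineq n x01.
have pow : (1 - 2 * c / a) ^+ n <= (a' / a) ^+ n.
  rewrite lerXn2r ?nnegrE //; first by rewrite subr_ge0.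
    by rewrite divr_ge0 // ?ltW //; lra.
  by rewrite ler_pdivlMr // mulrBl mul1r divfK ?gt_eqF.
have small : n%:R * (2 * c / a) <= 1 / 2.
  apply: le_trans (ler_wpM2r x0 nc) _.
  by rewrite mulrA ler_pdivrMr //; lra.
have half : 1 / 2 <= a' ^+ n / a ^+ n by rewrite -expr_div_n; lra.
by rewrite ler_pdivlMr ?exprn_gt0 // in half; lra.
Qed.

Lemma half_exponent (v w : nat) (d p : R) : 0 <= d -> 1 <= p -> (2 * w <= v)%N ->
  d ^+ v <= p ^+ 2 -> d ^+ w <= p.
Proof.
move=> d0 p1 wv h; have [d1|d1] := lerP d 1.
  by apply: le_trans p1; rewrite exprn_ile1.
have : (d ^+ w) ^+ 2 <= p ^+ 2.
  rewrite -exprM; apply: le_trans h; rewrite ler_weXn2l //; first exact: ltW.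
  by rewrite mulnC.
by rewrite ler_sqr ?nnegrE ?exprn_ge0 //; lra.
Qed.

(** Halving [V] increases [V ^ -1] by at least itself, and
[1 - 2 / V <= (1 - 1 / V) ^ 2] leaves room for one more factor [1 - 1 / V]. *)
Lemma loss_step (V W x y : R) : 2 <= V -> 0 < W -> 2 * W <= V ->
  2 ^+ 14 * (1 - V^-1) <= x -> (1 - V^-1) * x <= y -> 2 ^+ 14 * (1 - W^-1) <= y.
Proof.
move=> V2 W0 WV hx; apply: le_trans.
have Vi : 0 <= V^-1 <= 1 / 2.
  apply/andP; split; first by rewrite invr_ge0; lra.
  have -> : 1 / 2 = 2^-1 :> R by rewrite mul1r.
  by rewrite lef_pV2 ?posrE; lra.
have W2i : 2 * V^-1 <= W^-1.
  have -> : 2 * V^-1 = (V / 2)^-1 by rewrite invf_div.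
  by rewrite lef_pV2 ?posrE; lra.
have Vi1 : 0 <= 1 - V^-1 by lra.
apply: le_trans (ler_wpM2l Vi1 hx).
have := sqr_ge0 V^-1.
rewrite mulrCA -expr2 sqrrB expr1n mul1r.
clear -W2i; move: (V^-1 ^+ 2) (V^-1) W2i => z t W2i hz; lra.
Qed.

(** The density grows little: [X' <= 4 * U] bounds [d' ^ v] by about [U / a],
and [a] is itself at least about [d ^ - v / V].  Hence [(d' / d) ^ v] is at most
a polynomial in [V], small enough for the first condition of [supply] to pass
to half the exponent. *)
Lemma next_dens_bound (a d a' d' U V W : R) (v : nat) : 0 < a -> 0 <= d -> 0 <= d' ->
  a <= 2 * a' -> 0 <= V -> U <= 3 * V -> V <= 4 * W -> (2 * d) ^+ v <= V ^+ 2 ->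
  15 * 2 ^+ 13 <= 16 * V * (a * d ^+ v) -> a' * d' ^+ v <= 4 * U ->
  (2 * d') ^+ v <= (W ^+ 2) ^+ 2.
Proof.
move=> a0 d0 d'0 aa' V0 U3 V4 hd hX X'4.
have X0 : 0 <= a * d ^+ v by rewrite mulr_ge0 ?exprn_ge0 // ltW.
have V20 : 0 <= V ^+ 2 by rewrite exprn_ge0.
have h1 : (2 * d') ^+ v * (a * d ^+ v) <= 24 * V * V ^+ 2.
  have -> : (2 * d') ^+ v * (a * d ^+ v) = (a * d' ^+ v) * (2 * d) ^+ v by rewrite !exprMn; ring.
  apply: ler_pM => //; first by rewrite mulr_ge0 ?exprn_ge0 // ltW.
    by rewrite exprn_ge0 // mulr_ge0.
  apply: (@le_trans _ _ (2 * a' * d' ^+ v)); first by rewrite ler_wpM2r ?exprn_ge0.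
  by rewrite -mulrA; lra.
have D0 : 0 <= (2 * d') ^+ v by rewrite exprn_ge0 // mulr_ge0.
have h4 : (2 * d') ^+ v * (15 * 2 ^+ 13) <= 16 * V * (24 * V * V ^+ 2).
  apply: le_trans (ler_wpM2l D0 hX) _.
  by rewrite mulrCA ler_wpM2l // mulr_ge0.
have h5 : V ^+ 4 <= (4 * W) ^+ 4 by rewrite lerXn2r ?nnegrE //; lra.
have e1 : 16 * V * (24 * V * V ^+ 2) = 384 * V ^+ 4 by ring.
have e2 : (4 * W) ^+ 4 = 256 * (W ^+ 2) ^+ 2 by ring.
have W4 : 0 <= (W ^+ 2) ^+ 2 by rewrite exprn_ge0 // exprn_ge0 //; lra.
clear -h4 h5 e1 e2 W4; lra.
Qed.

(** If the degree [a' * d'] were below [16 * W ^ 2], then [d'] would be of the order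
of [d ^ v], which is too small for [1 <= b * d' ^ w]: the class [B] has only
about [d ^ - u] vertices, and [u <= 3 * v]. *)
Lemma degree_not_too_small (u v : nat) (a b d a' d' U V W : R) (w := v./2) :
  (81 <= v)%N -> (u <= 3 * v)%N -> 0 < a -> 0 < b -> 0 < d <= 1 -> 0 <= d' -> a <= 2 * a' ->
  V = v%:R -> 0 <= W -> 2 * W <= V -> U <= 3 * V -> (2 * d) ^+ v <= V ^+ 2 -> 1 <= U * (a * d ^+ v) ->
  15 * (b * d ^+ u) <= 16 * V -> 1 <= b * d' ^+ w -> 16 * W ^+ 2 <= a' * d'.
Proof.
move=> v81 uv; have [k kE] : exists k, w = (k + 8)%N by exists (w - 8)%N; rewrite /w; lia.
have [_ P8] := poly_bounds_81 v81.
have V81 : 81 <= v%:R :> R by rewrite (ler_nat R 81).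
move=> a0 b0 /andP[d0 d1] d'0 aa' VE W0 WV U3 hd hX hY bd'; rewrite -VE in P8 V81.
have V0 : 0 <= V by lra.
rewrite leNgt; apply/negP => had.
have p0 : 0 < d ^+ v by rewrite exprn_gt0.
have V2 : 0 <= V ^+ 2 by rewrite exprn_ge0.
have V21 : V <= V ^+ 2 by rewrite expr2 ler_peMl //; lra.
have V3 : V ^+ 2 <= V ^+ 3 by rewrite [V ^+ 3]exprS ler_peMl //; lra.
apply: (@dens_not_too_small k b (d ^+ v) d' (24 * V ^+ 3)); rewrite -?kE //.
- exact: ltW.
- by lra.
- rewrite -(ler_pM2r (exprn_gt0 v (ltr0n R 2))) mul1r.
  have -> : (24 * V ^+ 3) ^+ 2 * d ^+ v * 2 ^+ v = 576 * V ^+ 6 * (2 * d) ^+ v.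
    by rewrite [(2 * d) ^+ v]exprMn; ring.
  apply: le_trans P8; have -> : 576 * V ^+ 8 = 576 * V ^+ 6 * V ^+ 2 by ring.
  by rewrite ler_wpM2l // mulr_ge0 // exprn_ge0.
- rewrite -(ler_pM2l a0).
  apply: (@le_trans _ _ (2 * (a' * d'))); first by rewrite mulrA ler_wpM2r.
  apply: (@le_trans _ _ (8 * V ^+ 2)).
    have : (2 * W) ^+ 2 <= V ^+ 2 by rewrite lerXn2r ?nnegrE // mulr_ge0.
    by rewrite exprMn; lra.
  have -> : a * (24 * V ^+ 3 * d ^+ v) = 8 * V ^+ 2 * (3 * V * (a * d ^+ v)) by ring.
  rewrite ler_peMr //; first by rewrite mulr_ge0.
  by apply: le_trans hX _; rewrite ler_wpM2r // mulr_ge0 ?ltW.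
- rewrite -exprM mulnC; apply: (@le_trans _ _ (b * d ^+ u)).
    by rewrite (ler_pM2l b0) ler_wiXn2l // ltW.
  by lra.
Qed.

Lemma inv_le_half (Z : R) : 2 <= Z -> Z^-1 <= 1 / 2.
Proof.
move=> hZ; have -> : 1 / 2 = 2^-1 :> R by rewrite mul1r.
by rewrite lef_pV2 ?posrE; lra.
Qed.

(** The roles of the classes are exchanged, as [v] is now the larger target.
The second alternative, in which the new [X] is tiny and hence the new [Y]
huge, consists of the hypotheses of [kovari_sos_turan]. *)
Lemma next_supply (u v : nat) (a b d a' b' d' : R) (w := v./2) :
  (81 <= v)%N -> (v <= u <= 2 * v + 1)%N -> 0 < a -> 0 < b -> 0 < d <= 1 ->
  supply u v a b d -> 15 * (b * d ^+ u) <= 16 * v%:R ->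
  a - 2 * v%:R <= a' -> 0 <= b' <= b -> 0 <= d' ->
  (1 - v%:R^-1) * ((a * d ^+ v) * (b * d ^+ u)) <= (a' * d' ^+ v) * (b' * d' ^+ w) ->
  (a' * d') ^+ v <= 2 * u%:R * a ^+ v.-1 ->
  supply v w b' a' d' \/
  16 * w%:R ^+ 2 <= a' * d' /\ 16 * v%:R <= 15 * (b' * d' ^+ w).
Proof.
move=> v81 uvb.
have wv : (2 * w <= v)%N by rewrite /w; lia.
have vw : (v <= 4 * w)%N by rewrite /w; lia.
have w40 : (40 <= w)%N by rewrite /w; lia.
have uv3 : (u <= 3 * v)%N by lia.
have vE : v.-1.+1 = v by lia.
have v1v : v.-1%:R <= v%:R :> R by rewrite ler_nat; lia.
move=> a0 b0 /andP[d0 d1] g hY aa' /andP[b'0 b'b] d'0 pot hmax.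
have [hlarge _] := supply_degrees_81 (ltW a0) (ltW b0) (ltW d0) v81 uvb g.
have [hd hF hXl _] := g.
have V81 : 81 <= v%:R :> R by rewrite (ler_nat R 81).
have W40 : 40 <= w%:R :> R by rewrite (ler_nat R 40).
have W2 : 2 * w%:R <= v%:R :> R by rewrite -natrM ler_nat.
have W4 : v%:R <= 4 * w%:R :> R by rewrite -natrM ler_nat.
have U3 : u%:R <= 3 * v%:R :> R by rewrite -natrM ler_nat.
have UE : 0 <= u%:R :> R by [].
have aL : 16 * v%:R ^+ 3 <= a.
  by apply: le_trans hlarge _; rewrite ler_piMr // ltW.
have wide := @degree_not_too_small u v a b d a' d' u%:R v%:R w%:R v81 uv3 a0 b0.
rewrite /supply; move: (v%:R : R) (u%:R : R) (w%:R : R) V81 W40 W2 W4 U3 UE aL v1v aa' hmax hd hF hXl pot hY wide.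
move=> V U W V81 W40 W2 W4 U3 UE aL v1v aa' hmax hd hF hXl pot hY wide.
have V0 : 0 <= V by clear -V81; lra.
have V2 : V <= V ^+ 2 by rewrite expr2 ler_peMl //; clear -V81; lra.
have V3 : V ^+ 2 <= V ^+ 3 by rewrite [V ^+ 3]exprS ler_peMl ?exprn_ge0 //; clear -V81; lra.
have aa2 : a <= 2 * a' by clear -aL aa' V2 V3 V0; lra.
have a'0 : 0 < a' by clear -aa2 a0; lra.
have ratio : a ^+ v.-1 <= 2 * a' ^+ v.-1.
  by apply: (exp_le_double a0 V0 v1v _ _ aa'); clear -aL V2 V3 V0; lra.
pose X := a * d ^+ v; pose Y := b * d ^+ u.
pose X' := a' * d' ^+ v; pose Y' := b' * d' ^+ w.
have X'4 : X' <= 4 * U.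
  rewrite -(ler_pM2l (exprn_gt0 v.-1 a'0)).
  have -> : a' ^+ v.-1 * X' = (a' * d') ^+ v.
    by rewrite /X' exprMn -[in a' ^+ v]vE [a' ^+ v.-1.+1]exprS; ring.
  apply: le_trans hmax _.
  apply: le_trans (ler_wpM2l (mulr_ge0 (ler0n R 2) UE) ratio) _.
  by rewrite le_eqVlt; apply/orP; left; apply/eqP; ring.
have X0 : 0 < X by rewrite mulr_gt0 ?exprn_gt0.
have X'0 : 0 <= X' by rewrite mulr_ge0 ?exprn_ge0 // ltW.
have Y'0 : 0 <= Y' by rewrite mulr_ge0 ?exprn_ge0.
have hF' : 2 ^+ 14 * (1 - W^-1) <= X' * Y'.
  by apply: (@loss_step V W _ _ _ _ _ hF pot); clear -V81 W40 W2; lra.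
have F13 : 2 ^+ 13 <= X * Y.
  have : V^-1 <= 1 / 2 by apply: inv_le_half; clear -V81; lra.
  by clear -hF; rewrite /X /Y => ?; lra.
have F13' : 2 ^+ 13 <= X' * Y'.
  have : W^-1 <= 1 / 2 by apply: inv_le_half; clear -W40; lra.
  by clear -hF' => h; lra.
have hY' : 1 <= V * Y'.
  have : X' * Y' <= 4 * U * Y' by rewrite ler_wpM2r.
  have : U * Y' <= 3 * V * Y' by rewrite ler_wpM2r.
  clear -F13'; move: F13'; rewrite -!mulrA; move: (X' * Y') (U * Y') (V * Y') => x y z; lra.
have X16 : 15 * 2 ^+ 13 <= 16 * V * X.
  have : X * (15 * Y) <= X * (16 * V) by rewrite ler_pM2l.
  clear -F13; move: F13; have -> : X * (15 * Y) = 15 * (X * Y) by ring.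
  have -> : X * (16 * V) = 16 * V * X by ring.
  move: (X * Y) (16 * V * X) => x y; lra.
(* The first condition of the invariant holds in either case; the one that
   can fail is that [X'] is not tiny. *)
case: (lerP 1 (V * X')) => hX'.
  left; split=> //; last by rewrite [leRHS]mulrC.
  have W1 : 1 <= W ^+ 2 by rewrite exprn_ege1 //; clear -W40; lra.
  apply: (half_exponent _ W1 wv); first by rewrite mulr_ge0.
  exact: (@next_dens_bound a d a' d' U V W v a0 (ltW d0) d'0 aa2 V0 U3 W4 hd X16 X'4).
have Y'V : 2 ^+ 13 * V <= Y'.
  have : V * X' * Y' <= Y' by rewrite -[leRHS]mul1r ler_wpM2r // ltW.
  have : V * 2 ^+ 13 <= V * (X' * Y') by rewrite ler_wpM2l.
  by rewrite mulrA [2 ^+ 13 * V]mulrC; apply: le_trans.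
right; split; last by rewrite -/Y'; clear -Y'V V0; lra.
apply: wide; rewrite ?d0 //; first by clear -W40; lra.
apply: (@le_trans _ _ Y'); last by rewrite ler_wpM2r ?exprn_ge0.
by clear -Y'V V81; lra.
Qed.

(** * One round, and the induction *)

(** The degrees counted here are those at least the [v]-th root of
[2 * u * a ^ (v - 1)], where an average would give [X >= 2 * u].  The subgraph on the vertices of large degree has a density [d0] with
[a * d0 ^ v >= 2 * u], so it contains the biclique unless it has too few
vertices for the count. *)
Lemma few_high_degree (X Y : finType) (E : X -> Y -> bool) (A : {set X}) (B : {set Y}) u v :
  let d := dens E A B in
  (0 < u)%N -> (0 < v)%N -> (0 < #|A|)%N -> ~~ biclique E A B u v ->
  #|A|%:R * d ^+ v <= 2 * u%:R ->
  #|[set y in B | (2 * u * #|A| ^ v.-1 <= #|nbrs E A y| ^ v)%N]|%:R * d <= 16 * v%:R ^+ 2.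
Proof.
move=> d u0 v0 A0 nbi hX; set B0 := [set y in B | _].
have a0 : 0 < #|A|%:R :> R by rewrite ltr0n.
have vE : v.-1.+1 = v by rewrite prednK.
rewrite leNgt; apply: contra nbi => hB0.
have V0 : 0 < v%:R :> R by rewrite ltr0n.
have B0pos : (0 < #|B0|)%N.
  rewrite lt0n; apply: contraTN hB0 => /eqP ->; rewrite mul0r -leNgt.
  by rewrite mulr_ge0 // exprn_ge0.
have [y0 y0B] := card_gt0P B0pos.
pose m := #|nbrs E A [arg min_(y < y0 in B0) #|nbrs E A y|]|.
have mE : (2 * u * #|A| ^ v.-1 <= m ^ v)%N /\ forall y, y \in B0 -> (m <= #|nbrs E A y|)%N.
  rewrite /m; case: arg_minnP => // y yB ymin; split=> //.
  by move: yB; rewrite inE => /andP[].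
case: mE => m_large m_min; pose d0 : R := dens E A B0.
have bB0 : 0 < #|B0|%:R :> R by rewrite ltr0n.
have md0 : m%:R <= #|A|%:R * d0.
  have -> : #|A|%:R * d0 = (edges E A B0)%:R / #|B0|%:R.
    by rewrite /d0 /dens; field; rewrite !gt_eqF.
  rewrite ler_pdivlMr // -natrM ler_nat /edges mulnC -sum_nat_const.
  exact: leq_sum.
have hX0 : 2 * u%:R <= #|A|%:R * d0 ^+ v.
  rewrite -(ler_pM2l (exprn_gt0 v.-1 a0)) [leRHS]mulrA -exprSr vE -exprMn.
  apply: (@le_trans _ _ (m%:R ^+ v)).
    by rewrite mulrC -!natrX -!natrM ler_nat.
  by rewrite lerXn2r ?nnegrE //; apply: le_trans md0.
have dd0 : d <= d0.
  rewrite -(@ler_pXn2r _ v) ?nnegrE ?dens_ge0 //.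
  by rewrite -(ler_pM2l a0); apply: le_trans hX0.
have : biclique E A B0 u v.
  apply: kovari_sos_turan => //.
    by apply: le_trans (ltW hB0) _; rewrite ler_wpM2l.
  have : 0 <= u%:R :> R by [].
  by rewrite -/d0; clear -hX0; lra.
move=> /bicliqueP[S [T [sSA sTB0 cS cT h]]]; apply/bicliqueP; exists S, T; split=> //.
by apply: subset_trans sTB0 _; apply/subsetP => y; rewrite inE => /andP[].
Qed.

Lemma edges_le_max (X Y : finType) (E : X -> Y -> bool) (A : {set X}) (B : {set Y}) (M : R) n :
  (0 < n)%N -> 0 <= M -> (forall y, y \in B -> #|nbrs E A y|%:R ^+ n <= M) ->
  ((edges E A B)%:R / #|B|%:R) ^+ n <= M.
Proof.
move=> n0 M0 hM; have [B0|Bpos] := posnP #|B|.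
  by rewrite B0 invr0 mulr0 expr0n gtn_eqF.
have [y0 y0B] := card_gt0P Bpos.
have [y yB ymax] := arg_maxnP (fun y => #|nbrs E A y|) y0B.
apply: le_trans (hM y yB); rewrite lerXn2r ?nnegrE ?divr_ge0 //.
rewrite ler_pdivrMr ?ltr0n // -natrM ler_nat mulnC -sum_nat_const.
exact: leq_sum.
Qed.

(** The average degree, computed after the deletion of [m] vertices and with the
[s] chosen vertices left out, loses a relative [1 / (4 * V ^ 2)] at most; this
is multiplied by [u + v <= 4 * V] in the product, which gives [1 / V]. *)
Lemma trimmed_density (a b d e1 m s V : R) : 0 < V -> 0 <= a -> 0 <= b -> 0 < d -> 0 <= m ->
  a * b * d - a * m <= e1 -> s <= 2 * V -> m * d <= 16 * V ^+ 2 ->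
  16 * V ^+ 3 <= a * d -> 128 * V ^+ 4 <= b * d ^+ 2 ->
  a * d * (1 - (4 * V ^+ 2)^-1) * b <= e1 - s * b.
Proof.
move=> V0 a0 b0 d0 m0 he hs hm ha hb.
have V2 : 0 < 4 * V ^+ 2 by rewrite mulr_gt0 ?exprn_gt0.
have h1 : m * (8 * V ^+ 2) <= b * d.
  have : m * (128 * V ^+ 4) <= m * (b * d ^+ 2) by rewrite ler_wpM2l.
  have -> : m * (b * d ^+ 2) = (m * d) * (b * d) by ring.
  have : m * d * (b * d) <= 16 * V ^+ 2 * (b * d) by rewrite ler_wpM2r // mulr_ge0 // ltW.
  have -> : m * (128 * V ^+ 4) = 16 * V ^+ 2 * (m * (8 * V ^+ 2)) by ring.
  move=> h2 h3; rewrite -(@ler_pM2l _ (16 * V ^+ 2)) ?mulr_gt0 ?exprn_gt0 //.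
  exact: le_trans h3 h2.
have h2 : a * m <= a * b * d / (4 * V ^+ 2) / 2.
  have -> : a * b * d / (4 * V ^+ 2) / 2 = a * (b * d / (8 * V ^+ 2)) by field; rewrite gt_eqF.
  by rewrite ler_wpM2l // ler_pdivlMr // mulr_gt0 ?exprn_gt0.
have h3 : s * b <= a * b * d / (4 * V ^+ 2) / 2.
  have -> : a * b * d / (4 * V ^+ 2) / 2 = (a * d / (8 * V ^+ 2)) * b by field; rewrite gt_eqF.
  rewrite ler_wpM2r // ler_pdivlMr ?mulr_gt0 ?exprn_gt0 //.
  apply: le_trans ha; have -> : 16 * V ^+ 3 = 2 * V * (8 * V ^+ 2) by ring.
  by rewrite ler_wpM2r // mulr_ge0 ?exprn_ge0 ?ltW.
have -> : a * d * (1 - (4 * V ^+ 2)^-1) * b = a * b * d - a * b * d / (4 * V ^+ 2) by ring.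
clear -h2 h3 he; lra.
Qed.

(** One round for a graph without the biclique: delete the vertices of [B] of
large degree, then choose [u - v / 2] vertices of [A]. *)
Lemma next_graph (X Y : finType) (E : X -> Y -> bool) (A : {set X}) (B : {set Y}) u v
  (w := v./2) (d : R := dens E A B) :
  (81 <= v)%N -> (v <= u <= 2 * v + 1)%N -> supply u v #|A|%:R #|B|%:R d ->
  ~~ biclique E A B u v -> 15 * (#|A|%:R * d ^+ v) <= 16 * u%:R ->
  15 * (#|B|%:R * d ^+ u) <= 16 * v%:R ->
  exists (S : {set X}) (B1 : {set Y}),
    [/\ S \subset A, (#|S| + w = u)%N, B1 \subset B &
     let B' := common_nbrs E B1 S in let d' := dens E (A :\: S) B' in
     supply v w #|B'|%:R #|A :\: S|%:R d' \/
     16 * w%:R ^+ 2 <= #|A :\: S|%:R * d' /\ 16 * v%:R <= 15 * (#|B'|%:R * d' ^+ w)].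
Proof.
move=> v81 uvb.
have v0 : (0 < v)%N by lia.
have u0 : (0 < u)%N by lia.
have v40 : (40 <= v)%N by lia.
have swu : (u - w + w)%N = u by rewrite /w; lia.
have s2v : (u - w <= 2 * v)%N by rewrite /w; lia.
have uv4 : (u + v <= 4 * v)%N by lia.
set s := (u - w)%N in swu s2v.
have suv : (s + (w + v))%N = (u + v)%N by rewrite addnA swu.
move=> g nbi hX hY.
have [a0 b0 d0] := supply_gt0 (ler0n _ _) (ler0n _ _) (dens_ge0 E A B) v0 u0 g.
have [had hbd] := supply_degrees_81 (ler0n _ _) (ler0n _ _) (dens_ge0 E A B) v81 uvb g.
have d1 : d <= 1.
  by apply: le_trans (supply_dens (dens_ge0 E A B) v40 g) _; clear; lra.
have A0 : (0 < #|A|)%N by rewrite -(ltr0n R).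
have U0 : 0 <= u%:R :> R by [].
have hX2 : #|A|%:R * d ^+ v <= 2 * u%:R by clear -hX U0; lra.
have few := few_high_degree u0 v0 A0 nbi hX2.
set B0 := [set y in B | _] in few.
pose B1 := B :\: B0; have sB1 : B1 \subset B by apply: subsetDl.
have V0 : 0 < v%:R :> R by rewrite ltr0n.
have eE : (edges E A B)%:R = #|A|%:R * #|B|%:R * d :> R.
  by rewrite /d /dens; field; rewrite !gt_eqF.
have e1 : #|A|%:R * #|B|%:R * d - #|A|%:R * #|B0|%:R <= (edges E A B1)%:R.
  rewrite -eE lerBlDr -natrM -natrD ler_nat.
  rewrite /edges (big_setID B0) /= addnC leq_add2l.
  have -> : B :&: B0 = B0.
    by apply/setIidPr/subsetP => y; rewrite inE => /andP[].
  exact: edges_le.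
have S2 : s%:R <= 2 * v%:R :> R by rewrite -natrM ler_nat.
have trim := trimmed_density V0 (ltW a0) (ltW b0) d0 (ler0n _ _) e1 S2 few had hbd.
set l := (4 * v%:R ^+ 2)^-1 in trim.
have l01 : 0 <= l <= 1.
  rewrite invr_ge0 mulr_ge0 ?exprn_ge0 //= invf_le1 ?mulr_gt0 ?exprn_gt0 //.
  by rewrite -natrX -natrM (ler_nat R 1) muln_gt0 expn_gt0 v0.
have [l0 l1] := andP l01.
pose x := #|A|%:R * d * (1 - l).
have x0 : 0 <= x.
  by apply: mulr_ge0; [apply: mulr_ge0 => //; apply: ltW | rewrite subr_ge0].
have l1' : l < 1.
  rewrite invf_lt1 ?mulr_gt0 ?exprn_gt0 //.
  by rewrite -natrX -natrM (ltr_nat R 1) (@leq_trans (4 * 1)) // leq_mul2l expn_gt0 v0.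
have x1 : 0 < x * #|B|%:R.
  by apply: mulr_gt0 => //; apply: mulr_gt0; [apply: mulr_gt0 | rewrite subr_gt0].
have e1pos : (0 < edges E A B1)%N.
  rewrite -(ltr0n R).
  have : 0 <= s%:R * #|B|%:R :> R by rewrite mulr_ge0.
  by move: trim; rewrite -/x; clear -x1; lra.
have B1pos : (0 < #|B1|)%N.
  rewrite lt0n; apply: contraTN e1pos => /eqP B10; rewrite -leqNgt.
  by apply: leq_trans (edges_le _ _ _) _; rewrite B10 muln0.
have b1 : 0 < #|B1|%:R :> R by rewrite ltr0n.
have b1b : #|B1|%:R <= #|B|%:R :> R by rewrite ler_nat subset_leq_card.
pose g1 : R := (edges E A B1)%:R / #|B1|%:R.
have trim1 : x * #|B|%:R <= #|B1|%:R * (g1 - s%:R).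
  have -> : #|B1|%:R * (g1 - s%:R) = (edges E A B1)%:R - s%:R * #|B1|%:R.
    by rewrite /g1; field; rewrite gt_eqF.
  apply: le_trans trim _; rewrite lerD2l lerN2 ler_wpM2l //.
have sg1 : s%:R < g1.
  by rewrite -subr_gt0 -(pmulr_rgt0 _ b1); apply: lt_le_trans trim1.
have [S [sSA cS hS]] := dense_common_nbrs (w + v) sg1.
exists S, B1; split=> //; first by rewrite cS.
move=> B' d'; rewrite -/B' suv -/g1 in hS.
have A'c : (#|A :\: S| + s)%N = #|A| by rewrite cardsD (setIidPr sSA) cS subnK // -cS subset_leq_card.
have a'E : #|A :\: S|%:R = #|A|%:R - s%:R :> R by rewrite -A'c natrD addrK.
have sa : s%:R < #|A|%:R :> R.
  apply: lt_le_trans sg1 _; rewrite ler_pdivrMr // -natrM ler_nat.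
  exact: edges_le.
have a'0 : 0 < #|A :\: S|%:R :> R by rewrite a'E subr_gt0.
have a'a : #|A :\: S|%:R <= #|A|%:R :> R by rewrite a'E gerBl.
have hE : (edges E (A :\: S) B')%:R / #|B'|%:R = #|A :\: S|%:R * d' :> R.
  by rewrite /d' /dens invfM mulrCA mulVKf ?gt_eqF.
rewrite hE in hS.
apply: (next_supply v81 uvb a0 b0 _ g hY) => //.
- by rewrite d0.
- by rewrite a'E lerD2l lerN2.
- rewrite ler0n /= ler_nat; apply: subset_leq_card; apply: subset_trans sB1.
  by apply/subsetP => y; rewrite inE => /andP[].
- exact: dens_ge0.
- have uvE : (u + v)%N = (u + v).-1.+1 by rewrite prednK // addn_gt0 u0.
  have persp : #|B|%:R * x ^+ (u + v) <= #|B1|%:R * (g1 - s%:R) ^+ (u + v).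
    by rewrite uvE power_perspective // b1.
  have := @potential_step w s v #|A|%:R #|B|%:R d #|A :\: S|%:R #|B'|%:R d' l v0 a0 b0 d0.
  rewrite (ltW a'0) a'a suv -[(s + w + v)%N]addnA suv [(s + w)%N]addnC.
  rewrite [(w + s)%N]addnC swu.
  move=> /(_ isT (ler0n _ _) (dens_ge0 _ _ _) l01 (le_trans persp hS)).
  apply: le_trans; rewrite ler_wpM2r //; first by rewrite !mulr_ge0 ?exprn_ge0 // ltW.
  rewrite lerD2l lerN2 /l ler_pdivrMr ?mulr_gt0 ?exprn_gt0 //.
  have -> : v%:R^-1 * (4 * v%:R ^+ 2) = 4 * v%:R :> R by field; rewrite gt_eqF.
  by rewrite -natrM ler_nat.
rewrite -hE; apply: edges_le_max => //; first by rewrite !mulr_ge0 // exprn_ge0.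
move=> y; rewrite inE => /andP[yB1 _]; move: yB1; rewrite !inE negb_and => /andP[+ yB].
rewrite yB /= -ltnNge => lt_y.
rewrite -!natrX -!natrM ler_nat; apply: leq_trans (ltnW lt_y).
rewrite leq_exp2r // subset_leq_card //; apply/subsetP => z.
by rewrite !inE => /andP[/andP[_ ->] ->].
Qed.

Lemma supply_biclique v (X Y : finType) (E : X -> Y -> bool) (A : {set X}) (B : {set Y}) u :
  (40 <= v)%N -> (v <= u <= 2 * v + 1)%N -> supply u v #|A|%:R #|B|%:R (dens E A B) ->
  biclique E A B u v.
Proof.
elim/ltn_ind: v X Y E A B u => v IH X Y E A B u v40 uvb g.
have v0 : (0 < v)%N by lia.
have u0 : (0 < u)%N by lia.
have [//|nbi] := boolP (biclique E A B u v); exfalso.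
have [had hbd] := supply_degrees (ler0n _ _) (ler0n _ _) (dens_ge0 E A B) v40 uvb g.
have hX : 15 * (#|A|%:R * dens E A B ^+ v) <= 16 * u%:R.
  by rewrite leNgt; apply: contra nbi => /ltW; apply: kovari_sos_turan.
have hY : 15 * (#|B|%:R * dens E A B ^+ u) <= 16 * v%:R.
  rewrite leNgt; apply: contra nbi => /ltW h; apply: biclique_flip.
  by apply: kovari_sos_turan => //; rewrite dens_flip.
have [v81|v80] := leqP 81 v.
  have ww : (v./2 < v)%N by lia.
  have w40 : (40 <= v./2)%N by lia.
  have w0 : (0 < v./2)%N by lia.
  have wvb : (v./2 <= v <= 2 * v./2 + 1)%N by lia.
  have [S [B1 [sSA cS sB1 h]]] := next_graph v81 uvb g nbi hX hY.
  move/negP: nbi; apply; rewrite -cS; apply: biclique_extend sSA sB1 _.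
  apply: biclique_flip; case: h => [g'|[h1 h2]].
    by apply: IH => //; rewrite dens_flip.
  by apply: kovari_sos_turan w0 _ _; rewrite dens_flip; [exact: h1 | exact: h2].
(* Here [225 * X * Y <= 256 * u * v], although [X * Y >= 2 ^ 14 * 39 / 40]. *)
have uv : (u * v <= 161 * 80)%N.
  by apply: leq_mul => //; clear -v80 uvb; lia.
have [_ hF _ _] := g.
have : (15 * (#|A|%:R * dens E A B ^+ v)) * (15 * (#|B|%:R * dens E A B ^+ u))
   <= (16 * u%:R) * (16 * v%:R).
  by apply: ler_pM => //; rewrite !mulr_ge0 ?exprn_ge0 ?dens_ge0.
have uvR : u%:R * v%:R <= 161 * 80 :> R.
  by rewrite -[leLHS]natrM -[leRHS]natrM (ler_nat R) uv.
have Vi : v%:R^-1 <= 1 / 40 :> R.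
  have -> : 1 / 40 = 40^-1 :> R by rewrite mul1r.
  by rewrite lef_pV2 ?posrE ?ltr0n // (ler_nat R 40).
set X1 := #|A|%:R * _ in hF *; set Y1 := #|B|%:R * _ in hF *.
have -> : 15 * X1 * (15 * Y1) = 225 * (X1 * Y1) by ring.
have -> : 16 * u%:R * (16 * v%:R) = 256 * (u%:R * v%:R) :> R by ring.
clear -hF uvR Vi; lra.
Qed.

(** * The density version and the colouring *)

Lemma sqr_le_exp2 t : (t ^ 2 <= 4 * 2 ^ t)%N.
Proof.
elim: t => // t IH; have [t3|t3] := leqP 3 t; last by case: t t3 {IH} => [|[|[|]]].
rewrite [(2 ^ t.+1)%N]expnS; apply: (@leq_trans (2 * t ^ 2)); last by rewrite [(4 * _)%N]mulnCA leq_mul2l IH.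
by clear IH; nia.
Qed.

(** Up to [t = 100] the bound [X >= 128] suffices for the count.  For larger
[t], a graph without the biclique satisfies [supply t t]: its density is
about [1 / 2] at most, because [a * d ^ t] is below [2 * t] while
[a >= 128 * 2 ^ t]. *)
Lemma majority_biclique (X Y : finType) (E : X -> Y -> bool) (A : {set X}) (B : {set Y}) q t :
  (2 <= q)%N -> (0 < t)%N -> (128 * q ^ t <= #|A|)%N -> (128 * q ^ t <= #|B|)%N ->
  (#|A| * #|B| <= q * edges E A B)%N -> biclique E A B t t.
Proof.
move=> q2 t0 hA hB hE.
have q0 : (0 < q)%N by apply: leq_trans q2.
have qt0 : (0 < 128 * q ^ t)%N by rewrite muln_gt0 expn_gt0 q0.
have a0 : 0 < #|A|%:R :> R by rewrite ltr0n; apply: leq_trans hA.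
have b0 : 0 < #|B|%:R :> R by rewrite ltr0n; apply: leq_trans hB.
have Q0 : 0 < q%:R :> R by rewrite ltr0n.
set d : R := dens E A B.
have qd : 1 <= q%:R * d.
  rewrite /d /dens mulrA ler_pdivlMr ?mulr_gt0 // mul1r.
  by rewrite -!natrM ler_nat.
have d0 : 0 <= d by apply: dens_ge0.
have big_side (c : R) : 128 * q%:R ^+ t <= c -> 128 <= c * d ^+ t.
  move=> hc; apply: le_trans (ler_wpM2r (exprn_ge0 t d0) hc).
  by rewrite -mulrA -exprMn ler_peMr // exprn_ege1.
have RA : 128 * q%:R ^+ t <= #|A|%:R :> R by rewrite -natrX -natrM ler_nat.
have RB : 128 * q%:R ^+ t <= #|B|%:R :> R by rewrite -natrX -natrM ler_nat.
have X128 := big_side _ RA; have Y128 := big_side _ RB.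
have wide : 16 * t%:R ^+ 2 <= #|B|%:R * d.
  apply: (@le_trans _ _ (128 * q%:R ^+ t * d)); last by rewrite ler_wpM2r.
  have -> : 128 * q%:R ^+ t * d = 128 * q%:R ^+ t.-1 * (q%:R * d) :> R.
    by rewrite -{1}(prednK t0) exprS; ring.
  apply: (@le_trans _ _ (128 * q%:R ^+ t.-1)); last by rewrite ler_peMr // mulr_ge0 ?exprn_ge0.
  have : 2 ^+ t.-1 <= q%:R ^+ t.-1 :> R by rewrite lerXn2r ?nnegrE // (ler_nat R 2).
  have e2 : 2 ^+ t = 2 * 2 ^+ t.-1 :> R by rewrite -exprS prednK.
  have := sqr_le_exp2 t; rewrite -(ler_nat R) natrM !natrX e2.
  by clear => h1 h2; lra.
have [//|nbi] := boolP (biclique E A B t t); exfalso.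
have X_small : 15 * (#|A|%:R * d ^+ t) <= 16 * t%:R.
  by rewrite leNgt; apply: contra nbi => /ltW; apply: kovari_sos_turan.
have [t100|t100] := leqP t 100.
  have : t%:R <= 100 :> R by rewrite (ler_nat R _ 100).
  by clear -X128 X_small => h; lra.
have t40 : (40 <= t)%N by apply: leq_trans t100.
have tt : (t <= t <= 2 * t + 1)%N by rewrite leqnn; clear; lia.
have T1 : 1 <= t%:R :> R by rewrite ler1n.
have T2 : t%:R <= t%:R ^+ 2 :> R by rewrite expr2 ler_peMl.
move/negP: nbi; apply; apply: supply_biclique => //; split.
- have q2t : 2 ^+ t <= q%:R ^+ t :> R by rewrite lerXn2r ?nnegrE // (ler_nat R 2).
  have hd : 128 * (2 * d) ^+ t <= #|A|%:R * d ^+ t.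
    rewrite exprMn mulrA ler_wpM2r ?exprn_ge0 //; apply: le_trans RA.
    by rewrite ler_wpM2l.
  by rewrite -/d; clear -hd X_small T1 T2; lra.
- have h : 128 * 128 <= #|A|%:R * d ^+ t * (#|B|%:R * d ^+ t) by apply: ler_pM.
  have : 0 <= t%:R^-1 :> R by rewrite invr_ge0.
  by clear -h => h1; rewrite -/d; lra.
- rewrite -/d mulr_ege1 //; clear -X128; lra.
- rewrite -/d mulr_ege1 //; clear -Y128; lra.
Qed.

End Real.

Lemma majority_color (A B : finType) q (c : {ffun A * B -> 'I_q}) : (0 < q)%N ->
  exists k, (#|[set: A]| * #|[set: B]| <=
    q * edges (fun x y => c (x, y) == k) [set: A] [set: B])%N.
Proof.
move=> q0; pose e k := edges (fun x y => c (x, y) == k) [set: A] [set: B].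
have sum_e : (\sum_k e k = #|[set: A]| * #|[set: B]|)%N.
  rewrite /e /edges exchange_big mulnC -sum_nat_const; apply: eq_bigr => y _ /=.
  rewrite -[RHS]sum1_card (partition_big (fun x => c (x, y)) xpredT) //=.
  apply: eq_bigr => k _; rewrite -sum1_card.
  by apply: eq_bigl => x; rewrite !inE.
apply/existsP; apply: contraT => /existsPn small.
have : (\sum_k q * e k < \sum_(k < q) #|[set: A]| * #|[set: B]|)%N.
  have lt k : (q * e k < #|[set: A]| * #|[set: B]|)%N by rewrite ltnNge small.
  rewrite (bigD1 (Ordinal q0)) //= [X in (_ < X)%N](bigD1 (Ordinal q0)) //=.
  by rewrite -addSn leq_add // leq_sum // => k _; apply: ltnW.
by rewrite -big_distrr /= sum_e sum_nat_const card_ord ltnn.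
Qed.

Theorem corollary5p1 (q t : nat) (hq : 2 <= q) (ht : 1 <= t) :
  bip_ramsey q t <= 128 * q ^ t /\
  forall (A B : finType) (c : {ffun A * B -> 'I_q}),
    128 * q ^ t <= #|A| -> 128 * q ^ t <= #|B| -> has_mono_Ktt t c.
Proof.
have mono (A B : finType) (c : {ffun A * B -> 'I_q}) :
    128 * q ^ t <= #|A| -> 128 * q ^ t <= #|B| -> has_mono_Ktt t c.
  rewrite -!cardsT => hA hB; have [k hk] := majority_color c (ltnW hq).
  have /bicliqueP[S [T [_ _ cS cT h]]] := @majority_biclique rat _ _ _ _ _ _ _ hq ht hA hB hk.
  apply/existsP; exists k; apply/existsP; exists S; apply/existsP; exists T.
  rewrite cS cT !eqxx /=.
  by apply/forall_inP => x xS; apply/forall_inP => y yT; apply: h.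
split; last exact: mono.
rewrite /bip_ramsey; case: ex_minnP => n _; apply.
by apply/forallP => c; apply: mono; rewrite card_ord.
Qed.
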